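(* Let $n\ge 1$ be an integer and let $a<b\le c<d$ be real numbers. Let $\breve m$ be an uncertain random variable given by the polynomial degree $n$ fuzzy number $a/b/c/d$, with its polynomial possibility density function of degree $n$ (as defined in the context), and let $i_{\breve m}$ be the interval valued probability measure constructed from the corresponding possibility and necessity measures. Then the interval expected value of $i_{\breve m}$ is $$\int_{\mathbb{R}} x\, di_{\breve m}=\left[\,a+\frac{b-a}{n+1},\; d-\frac{d-c}{n+1}\,\right].$$
   Context: Polynomial degree $n$ fuzzy number $a/b/c/d$ (core $[b,c]$, support $[a,d]$): its polynomial possibility density function $f:\mathbb{R}\to[0,1]$ is $$f(x)=\begin{cases} f_L(x), & x\in[a,b),\\ 1, & x\in[b,c],\\ f_R(x), & x\in(c,d],\\ 0, & \text{otherwise,}\end{cases}$$ where $f_L(x)=\frac{1}{(b-a)^n}(x-b)^n+1$ if $n$ is odd, $f_L(x)=-\frac{1}{(b-a)^n}(x-b)^n+1$ if $n$ is even, and $f_R(x)=-\frac{1}{(d-c)^n}(x-c)^n+1$ for all $n$ (odd or even). Possibility and necessity measures: $Pos(A)=\sup\{f(x)\mid x\in A\}$ (with supremum over $\emptyset$ equal to $0$) and $Nec(A)=1-Pos(A^c)$. The interval valued probability measure (IVPM) constructed from $f$ is $i_{\breve m}(A)=[Nec(A),Pos(A)]$. The upper cumulative distribution function $F^u$ (given by the possibility measure) and the lower cumulative distribution function $F^l$ (given by the necessity measure) are $$F^u(x)=\begin{cases}0,& x<a,\\ f_L(x),& a\le x\le b,\\ 1,& b<x,\end{cases}\qquad F^l(x)=\begin{cases}0,&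 x<c,\\ 1-f_R(x),& c\le x\le d,\\ 1,& d<x.\end{cases}$$ The left density $d^-$ is the derivative of $F^u$, that is, $d^-(x)=f_L'(x)$ for $a\le x\le b$ and $d^-(x)=0$ otherwise. The right density $d^+$ is the derivative of $F^l$, that is, $d^+(x)=-f_R'(x)$ for $c\le x\le d$ and $d^+(x)=0$ otherwise. The interval expected value of $i_{\breve m}$ is the interval $$\int_{\mathbb{R}}x\,di_{\breve m}=\left[\int_{-\infty}^{\infty}x\,d^-(x)\,dx,\ \int_{-\infty}^{\infty}x\,d^+(x)\,dx\right].$$ *)

(* Defs.v *)
From HB Require Import structures.
From mathcomp Require Import all_boot all_order all_algebra.
From mathcomp Require Import all_classical all_reals all_analysis.
Set Implicit Arguments.
Unset Strict Implicit.
Unset Printing Implicit Defensive.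
Import Order.TTheory GRing.Theory Num.Theory.
Import numFieldNormedType.Exports.
Local Open Scope classical_set_scope.
Local Open Scope ring_scope.

(* The possibility density of the polynomial degree n fuzzy number a/b/c/d. *)

Definition poly_left (R : realType) (n : nat) (a b : R) (x : R) : R :=
  if odd n then 1 / (b - a) ^+ n * (x - b) ^+ n + 1
  else - (1 / (b - a) ^+ n) * (x - b) ^+ n + 1.

Definition poly_right (R : realType) (n : nat) (c d : R) (x : R) : R :=
  - (1 / (d - c) ^+ n) * (x - c) ^+ n + 1.

Definition poly_possibility (R : realType) (n : nat) (a b c d : R) (x : R) : R :=
  if a <= x < b then poly_left n a b x
  else if b <= x <= c then 1
  else if c < x <= d then poly_right n c d x
  else 0.

(* The library's [sup] is 0 on the empty set ([sup0]), so [Pos f set0 = 0]. *)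
Definition Pos (R : realType) (f : R -> R) (A : set R) : R :=
  sup [set f x | x in A].

Definition Nec (R : realType) (f : R -> R) (A : set R) : R :=
  1 - Pos f (~` A).

Definition ivpm (R : realType) (f : R -> R) (A : set R) : interval R :=
  `[Nec f A, Pos f A].

(* For i = ivpm f with f a normal possibility density, [sup] and [inf] return
   the endpoints of the closed interval, so these functions are
   x |-> Pos f `]-oo, x] and x |-> Nec f `]-oo, x].
   For f = poly_possibility n a b c d, upper_cdf is 0 below a, poly_left on
   [a, b] and 1 above b; lower_cdf is 0 below c, 1 - poly_right on [c, d] and
   1 above d. *)
Definition upper_cdf (R : realType) (i : set R -> interval R) (x : R) : R :=
  sup [set` i `]-oo, x]%classic].

Definition lower_cdf (R : realType) (i : set R -> interval R) (x : R) : R :=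
  inf [set` i `]-oo, x]%classic].

(* In the polynomial case, left_density is the derivative of poly_left on [a, b]
   and 0 elsewhere, and right_density is minus the derivative of poly_right on
   [c, d] and 0 elsewhere, except possibly at the corners a, b (resp. c, d) of
   the distribution function: a null set, irrelevant to the integrals below. *)
Definition left_density (R : realType) (i : set R -> interval R) : R -> R :=
  (upper_cdf i)^`()%classic.

Definition right_density (R : realType) (i : set R -> interval R) : R -> R :=
  (lower_cdf i)^`()%classic.

(* The integrals are extended-real valued: a finite value of such an integral
   of a measurable function entails integrability. *)
Definition interval_expectation (R : realType) (i : set R -> interval R) :
    interval (\bar R) :=
  `[ (\int[lebesgue_measure]_(x in setT) (x * left_density i x)%:E)%E,
     (\int[lebesgue_measure]_(x in setT) (x * right_density i x)%:E)%E ].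

(* Main.v *)
Require Import Defs.
From HB Require Import structures.
From mathcomp Require Import all_boot all_order all_algebra.
From mathcomp Require Import all_classical all_reals all_analysis.
From mathcomp Require Import measurable_realfun ring lra.
Import Order.TTheory GRing.Theory Num.Theory.
Import numFieldNormedType.Exports.
Local Open Scope classical_set_scope.
Local Open Scope ring_scope.

(** The possibility density [f] lies between 0 and 1 and reaches 1 at [b], so
    [Nec f A <= Pos f A] for every [A] and the endpoints of [ivpm f A] can be
    read off: the upper distribution function is [x |-> Pos f `]-oo, x]] and
    the lower one is [x |-> 1 - Pos f `]x, +oo[] ([upper_cdfE], [lower_cdfE]).
    As [f] is nondecreasing left of [b], the supremum over [`]-oo, x]] is the
    value at [x] there and 1 from [b] on; as [f] is nonincreasing and continuous
    right of [c], the supremum over [`]x, +oo[] is again the value at [x] there,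
    and 1 before [c].

    The two edges of [f] have the same shape, whatever the parity of [n]: each
    is [1 - T ^+ n] with [T] the affine function that is 0 at the core and 1 at
    the end of the support ([T x = (x - b) / (a - b)] on the left and
    [T x = (x - c) / (d - c)] on the right). Both distribution functions are
    thus constant, then affine in [T ^+ n], then constant. For such a function
    [F], [x * F^`() x] agrees off two points with a polynomial cut off to an
    interval, and the fundamental theorem of calculus with the explicit
    antiderivative of [x * (T ^+ n)^`()] gives the two endpoints
    ([integral_id_derive1_ramp], [integral_id_derive1_power_ramp]). *)

(** * Possibility and necessity of a normal density *)

Lemma Pos_max {R : realType} (f : R -> R) (A : set R) (m : R) :
  A m -> (forall y, A y -> f y <= f m) -> Pos f A = f m.
Proof.
move=> Am fm; have ubm : ubound [set f x | x in A] (f m).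
  by move=> _ [y Ay <-]; exact: fm.
apply/eqP; rewrite eq_le; apply/andP; split.
  by apply: ge_sup => //; exists (f m), m.
by apply: ub_le_sup; [exists (f m)|exists m].
Qed.

Lemma Pos_ge {R : realType} (f : R -> R) (A : set R) (y : R) :
  (forall x, f x <= 1) -> A y -> f y <= Pos f A.
Proof.
move=> f1 Ay; apply: ub_le_sup; last by exists y.
by exists 1 => _ [z _ <-].
Qed.

Lemma Pos_ge0 {R : realType} (f : R -> R) (A : set R) :
  (forall x, 0 <= f x <= 1) -> 0 <= Pos f A.
Proof.
move=> f01; have [->|/set0P[y Ay]] := eqVneq A set0.
  by rewrite /Pos image_set0 sup0.
have /andP[fy0 _] := f01 y.
by apply: (le_trans fy0); apply: Pos_ge => // x; have /andP[] := f01 x.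
Qed.

(** The inequality amounts to [1 <= Pos f A + Pos f (~` A)], which holds because
    the point of possibility 1 lies in one of the two sets. *)
Lemma Nec_le_Pos {R : realType} (f : R -> R) (x0 : R) (A : set R) :
  (forall x, 0 <= f x <= 1) -> f x0 = 1 -> Nec f A <= Pos f A.
Proof.
move=> f01 fx0; have f1 x : f x <= 1 by have /andP[] := f01 x.
have := Pos_ge0 f A f01; have := Pos_ge0 f (~` A) f01; rewrite /Nec.
have [Ax0|Ax0] := pselect (A x0).
- by have := Pos_ge f A x0 f1 Ax0; rewrite fx0; lra.
- by have := Pos_ge f (~` A) x0 f1 Ax0; rewrite fx0; lra.
Qed.

Section normal_possibility.
Context {R : realType} (f : R -> R) (x0 : R).
Hypotheses (f01 : forall x, 0 <= f x <= 1) (fx0 : f x0 = 1).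

Lemma upper_cdfE x : upper_cdf (ivpm f) x = Pos f `]-oo, x].
Proof. by rewrite /upper_cdf sup_itvcc//; exact: (Nec_le_Pos f x0). Qed.

Lemma lower_cdfE x : lower_cdf (ivpm f) x = 1 - Pos f `]x, +oo[.
Proof.
by rewrite /lower_cdf inf_itvcc ?(Nec_le_Pos f x0)// /Nec setCitvl.
Qed.

End normal_possibility.

(** * Expectation of a ramp *)

(** The derivative of [F] is unknown at the corners [p] and [q], where [F] may
    even jump. It is determined elsewhere, and altering a function at two points
    changes neither its measurability nor its integral. *)
Lemma integral_id_derive1_ramp {R : realType} (F : R -> R) (P Q : {poly R})
    (p q r s : R) : p < q ->
  (forall x, x < p -> F x = r) ->
  (forall x, p < x < q -> F x = P.[x]) ->
  (forall x, q < x -> F x = s) ->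
  Q^`() = 'X * P^`() ->
  (\int[lebesgue_measure]_(x in setT) (x * F^`()%classic x)%:E =
   (Q.[q] - Q.[p])%:E)%E.
Proof.
move=> pq Fp FP Fq QP.
(* The integrand agrees with the cut-off polynomial g on the complement U of the
   corners. *)
pose U : set R := [set: R] `\ q `\ p.
have mU : measurable U by do 2![apply: measurableD => //].
pose g := (fun x : R => (Q^`().[x])%:E) \_ `]p, q[.
have mQ (D : set R) : measurable_fun D (fun x : R => (Q^`().[x])%:E : \bar R).
  apply/measurable_EFinP; apply: measurable_funTS.
  by apply: continuous_measurable_fun; exact: continuous_horner.
have mg D : measurable D -> measurable_fun D g.
  move=> mD; apply: measurable_funTS.
  by apply/(measurable_restrictT _ _).1.
have Fg : {in U, (fun x => (x * F^`()%classic x)%:E) =1 g}.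
  move=> x; rewrite inE /U /= => -[[_ /eqP xq] /eqP xp].
  rewrite /g patchE mem_setE in_itv/= derive1E.
  have [xltp|pltx|xep] := ltgtP x p; last by rewrite xep eqxx in xp.
  - rewrite (@near_eq_derive _ _ _ _ (cst r)) ?derive_cst ?mulr0//.
    by near=> y; apply: Fp; near: y; exact: lt_nbhsl.
  - have [xltq|qltx|xeq] := ltgtP x q; last by rewrite xeq eqxx in xq.
    + rewrite (@near_eq_derive _ _ _ _ (horner P)).
        by rewrite -derive1E -derivE QP hornerM hornerX.
      near=> y; apply: FP; apply/andP; split; near: y.
        exact: lt_nbhsr.
      exact: lt_nbhsl.
    + rewrite (@near_eq_derive _ _ _ _ (cst s)) ?derive_cst ?mulr0//.
      by near=> y; apply: Fq; near: y; exact: lt_nbhsr.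
(* The points are removed one at a time, and each removal requires that the
   integrand be measurable on what is left. *)
have mXF : measurable_fun U (fun x : R => (x * F^`()%classic x)%:E : \bar R).
  by apply: (eq_measurable_fun g); [move=> x xU; rewrite Fg|exact: mg].
have mXFq : measurable_fun ([set: R] `\ q)
    (fun x : R => (x * F^`()%classic x)%:E : \bar R).
  have pDq : ([set: R] `\ q) p by split=> //=; apply/eqP; rewrite lt_eqF.
  rewrite -(setD1K pDq).
  apply: (measurable_funU _ (measurable_set1 p) mU).2.
  by split; [exact: measurable_fun_set1|exact: mXF].
rewrite -(integral_setD1 (r := q))//; last exact: measurableD.
rewrite -(integral_setD1 (r := p))//.
transitivity (\int[lebesgue_measure]_(x in U) g x)%E.
  exact: eq_integral.
rewrite /U (integral_setD1 (r := p))//; last exact: mg.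
rewrite (integral_setD1 (r := q))//; last 2 first.
- exact: measurableD.
- by apply: mg; exact: measurableD.
rewrite -integral_mkcond -(integral_itv_bndoo true false)//.
rewrite (continuous_FTC2 (F := horner Q))//.
- by apply: continuous_subspaceT; exact: continuous_horner.
- split => [x _||].
  + exact: derivable_horner.
  + by apply: cvg_at_right_filter; exact: continuous_horner.
  + by apply: cvg_at_left_filter; exact: continuous_horner.
- by move=> x _; rewrite -derivE.
Unshelve. all: by end_near. Qed.

(** Up to the factor [e], integration by parts gives the antiderivative [G] of
    [x * (T ^+ n)^`()] for [T x = (x - m) / w]: it is [x * T ^+ n] minus the
    antiderivative [w / n.+1 * T ^+ n.+1] of [T ^+ n]. The width [w] may be
    negative, which is what lets the rising left edge, measured from the core
    towards [a], be treated like the right one. *)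
Lemma integral_id_derive1_power_ramp {R : realType} (F : R -> R) (n : nat)
    (m w e k p q r s : R) : p < q -> w != 0 ->
  (forall x, x < p -> F x = r) ->
  (forall x, p < x < q -> F x = k + e * ((x - m) / w) ^+ n) ->
  (forall x, q < x -> F x = s) ->
  let G x := e * (x * ((x - m) / w) ^+ n
                  - w / n.+1%:R * ((x - m) / w) ^+ n.+1) in
  (\int[lebesgue_measure]_(x in setT) (x * F^`()%classic x)%:E =
   (G q - G p)%:E)%E.
Proof.
move=> pq w0 Fp FT Fq G.
pose T : {poly R} := w^-1 *: ('X - m%:P).
have dT : T^`() = w^-1%:P.
  by rewrite /T derivZ derivB derivX derivC subr0 alg_polyC.
pose P : {poly R} := k%:P + e *: T ^+ n.
pose Q : {poly R} := e *: ('X * T ^+ n - (w / n.+1%:R) *: T ^+ n.+1).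
have QE x : Q.[x] = G x by rewrite /Q /G /T !(hornerE, horner_exp) (mulrC w^-1).
rewrite -!QE; apply: (integral_id_derive1_ramp F P Q p q r s) => //.
- by move=> x /FT ->; rewrite /P /T !(hornerE, horner_exp) (mulrC w^-1).
- have n0 : n.+1%:R != 0 :> R by rewrite pnatr_eq0.
  rewrite /P /Q derivD derivC add0r !derivZ -scalerAr; congr (_ *: _).
  rewrite derivB derivM derivX mul1r derivZ (deriv_exp T n.+1) dT.
  rewrite -[X in _ - _ *: X]scaler_nat mul_polyC !scalerA !mulrA.
  have -> : w / n.+1%:R * n.+1%:R * w^-1 = 1 by rewrite divfK ?divff.
  by rewrite scale1r addrC addKr.
Qed.

(** * The polynomial fuzzy number *)

(** Dividing by [a - b] instead of [b - a] absorbs the sign that depends on the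
    parity of [n]. *)
Lemma poly_leftE {R : realType} (n : nat) (a b x : R) : a < b ->
  poly_left n a b x = 1 - ((x - b) / (a - b)) ^+ n.
Proof.
move=> ab; have w0 : (b - a) ^+ n != 0 by rewrite expf_neq0 ?subr_eq0 ?gt_eqF.
rewrite /poly_left expr_div_n -(opprB b a) exprNn -signr_odd.
by case: (odd n); rewrite ?expr1 ?expr0; field.
Qed.

Lemma poly_rightE {R : realType} (n : nat) (c d x : R) :
  poly_right n c d x = 1 - ((x - c) / (d - c)) ^+ n.
Proof. by rewrite /poly_right expr_div_n div1r mulNr mulrC addrC. Qed.

Section polynomial_fuzzy_number.
Context {R : realType} (n : nat) (a b c d : R).
Hypotheses (hab : a < b) (hbc : b <= c) (hcd : c < d).

Local Notation f := (poly_possibility n a b c d).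

Lemma poly_possibility_below x : x < a -> f x = 0.
Proof.
move=> xa; have xb := lt_trans xa hab; have xc := lt_le_trans xb hbc.
by rewrite /poly_possibility (lt_geF xa) (lt_geF xb) (le_gtF (ltW xc)).
Qed.

Lemma poly_possibility_left x : a <= x < b ->
  f x = 1 - ((x - b) / (a - b)) ^+ n.
Proof. by move=> axb; rewrite /poly_possibility axb poly_leftE. Qed.

Lemma poly_possibility_core x : b <= x <= c -> f x = 1.
Proof.
move=> /andP[bx xc].
by rewrite /poly_possibility (le_gtF bx) andbF bx xc.
Qed.

Lemma poly_possibility_right x : c < x <= d ->
  f x = 1 - ((x - c) / (d - c)) ^+ n.
Proof.
move=> /[dup] cxd /andP[cx _]; have bx := le_trans hbc (ltW cx).
rewrite /poly_possibility (le_gtF bx) andbF (lt_geF cx) andbF cxd.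
exact: poly_rightE.
Qed.

Lemma poly_possibility_above x : d < x -> f x = 0.
Proof.
move=> dx; have cx := lt_trans hcd dx; have bx := le_trans hbc (ltW cx).
by rewrite /poly_possibility (le_gtF bx) (lt_geF cx) (lt_geF dx) !andbF.
Qed.

Let left_ratio x : a <= x <= b -> 0 <= (x - b) / (a - b) <= 1.
Proof.
move=> /andP[ax xb].
by rewrite ler_ndivlMr ?ler_ndivrMr ?subr_lt0//; apply/andP; split; lra.
Qed.

Let right_ratio x : c <= x <= d -> 0 <= (x - c) / (d - c) <= 1.
Proof.
move=> /andP[cx xd].
by rewrite ler_pdivlMr ?ler_pdivrMr ?subr_gt0//; apply/andP; split; lra.
Qed.

Lemma poly_possibility_bounds x : 0 <= f x <= 1.
Proof.
have onem_pow (t : R) : 0 <= t <= 1 -> 0 <= 1 - t ^+ n <= 1.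
  move=> /andP[t0 t1]; rewrite subr_ge0 exprn_ile1//=.
  by rewrite lerBlDr lerDl exprn_ge0.
have [xa|ax] := ltP x a; first by rewrite poly_possibility_below// lexx ler01.
have [xb|bx] := ltP x b.
  by rewrite poly_possibility_left ?ax// onem_pow// left_ratio// ax ltW.
have [xc|cx] := leP x c.
  by rewrite poly_possibility_core ?bx ?ler01 ?lexx.
have [xd|dx] := leP x d; last by rewrite poly_possibility_above// lexx ler01.
by rewrite poly_possibility_right ?cx// onem_pow// right_ratio// xd ltW.
Qed.

Let f_le1 x : f x <= 1.
Proof. by have /andP[] := poly_possibility_bounds x. Qed.

Let f_ge0 x : 0 <= f x.
Proof. by have /andP[] := poly_possibility_bounds x. Qed.

Let f_at_b : f b = 1.
Proof. by rewrite poly_possibility_core ?lexx. Qed.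

Lemma poly_possibility_nondecreasing x y : x <= y -> y < b -> f x <= f y.
Proof.
move=> xy yb; have [xa|ax] := ltP x a; first by rewrite poly_possibility_below.
have xb : x < b by exact: le_lt_trans yb.
have ay : a <= y by exact: le_trans xy.
have /andP[tx0 _] : 0 <= (x - b) / (a - b) <= 1 by rewrite left_ratio// ax ltW.
have /andP[ty0 _] : 0 <= (y - b) / (a - b) <= 1 by rewrite left_ratio// ay ltW.
rewrite !poly_possibility_left ?ax ?ay// lerB// lerXn2r ?nnegrE//.
by rewrite ler_wnM2r ?invr_le0 ?lerD2r// subr_le0 ltW.
Qed.

Lemma poly_possibility_nonincreasing x y : c < x -> x <= y -> f y <= f x.
Proof.
move=> cx xy; have [yd|dy] := leP y d; last first.
  by rewrite (poly_possibility_above _ dy).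
have cy : c < y by exact: lt_le_trans xy.
have xd : x <= d by exact: le_trans yd.
have /andP[tx0 _] : 0 <= (x - c) / (d - c) <= 1 by rewrite right_ratio// xd ltW.
have /andP[ty0 _] : 0 <= (y - c) / (d - c) <= 1 by rewrite right_ratio// yd ltW.
rewrite !poly_possibility_right ?cx ?cy// lerB// lerXn2r ?nnegrE//.
by rewrite ler_wpM2r ?invr_ge0 ?lerD2r// subr_ge0 ltW.
Qed.

Let cdf_upper x : upper_cdf (ivpm f) x = Pos f `]-oo, x].
Proof. exact: (upper_cdfE f b poly_possibility_bounds f_at_b). Qed.

Let cdf_lower x : lower_cdf (ivpm f) x = 1 - Pos f `]x, +oo[.
Proof. exact: (lower_cdfE f b poly_possibility_bounds f_at_b). Qed.

Lemma upper_cdf_ltb x : x < b -> upper_cdf (ivpm f) x = f x.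
Proof.
move=> xb; rewrite cdf_upper; apply: Pos_max => [|y] /=;
  rewrite in_itv/= ?lexx//.
by move=> yx; exact: poly_possibility_nondecreasing.
Qed.

Lemma upper_cdf_geb x : b <= x -> upper_cdf (ivpm f) x = 1.
Proof.
move=> bx; rewrite cdf_upper -f_at_b; apply: Pos_max => [|y _].
  by rewrite /= in_itv.
by rewrite f_at_b.
Qed.

Lemma lower_cdf_ltc x : x < c -> lower_cdf (ivpm f) x = 0.
Proof.
move=> xc; have fc : f c = 1 by rewrite poly_possibility_core ?lexx ?andbT.
rewrite cdf_lower (Pos_max f _ c) ?fc ?subrr//.
by rewrite /= in_itv/= andbT.
Qed.

(** The half-line [`]x, +oo[] does not contain [x], so the supremum need not be
    attained: it is the limit of [f] from the right at [x], which is [f x] by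
    continuity. *)
Lemma lower_cdf_gtc x : c < x -> lower_cdf (ivpm f) x = 1 - f x.
Proof.
move=> cx; rewrite cdf_lower; congr (1 - _).
have ub y : `]x, +oo[%classic y -> f y <= f x.
  rewrite /= in_itv/= andbT => /ltW; exact: poly_possibility_nonincreasing.
apply/eqP; rewrite eq_le; apply/andP; split.
  apply: ge_sup => [|_ [y xy <-]]; last exact: ub.
  by exists (f (x + 1)), (x + 1) => //=; rewrite in_itv/= andbT ltrDl.
have [xd|dx] := ltP x d; last first.
  have fd : f d = 0.
    rewrite poly_possibility_right ?hcd ?lexx// divff ?expr1n ?subrr//.
    by rewrite subr_eq0 gt_eqF.
  rewrite (le_trans (poly_possibility_nonincreasing _ _ hcd dx))// fd.
  exact: (Pos_ge0 f _ poly_possibility_bounds).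
pose P : {poly R} := 1 - ((d - c)^-1 *: ('X - c%:P)) ^+ n.
have PE y : c < y <= d -> P.[y] = f y.
  move=> cyd; rewrite poly_possibility_right// /P.
  by rewrite !(hornerE, horner_exp) mulrC.
rewrite -PE; last by rewrite cx ltW.
apply: (@cvgr_to_le _ (x^'+)%classic _ _ (horner P)).
  by apply: cvg_at_right_filter; exact: continuous_horner.
near=> y.
have xy : x < y by near: y; exact: nbhs_right_gt.
have yd : y < d by near: y; exact: nbhs_right_lt.
rewrite PE; last by rewrite (lt_trans cx xy) ltW.
by apply: Pos_ge; [exact: f_le1|rewrite /= in_itv/= andbT].
Unshelve. all: by end_near. Qed.

End polynomial_fuzzy_number.

Theorem mainTheorem1 (R : realType) (n : nat) (a b c d : R)
    (hn : (1 <= n)%N) (hab : a < b) (hbc : b <= c) (hcd : c < d) :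
  interval_expectation (ivpm (poly_possibility n a b c d)) =
  `[ (a + (b - a) / n.+1%:R)%:E, (d - (d - c) / n.+1%:R)%:E ].
Proof.
have n0 : n.+1%:R != 0 :> R by rewrite pnatr_eq0.
have zn : 0 ^+ n = 0 :> R by rewrite expr0n eqn0Ngt hn.
have ab0 : a - b != 0 by rewrite subr_eq0 lt_eqF.
have dc0 : d - c != 0 by rewrite subr_eq0 gt_eqF.
rewrite /interval_expectation; congr `[ _, _ ].
(* upper_cdf is 1 - T ^+ n on ]a, b[ with T = 1 at a and T = 0 at b, so the
   integral is G b - G a = 0 - G a. *)
- rewrite (integral_id_derive1_power_ramp _ n b (a - b) (- 1) 1 a b 0 1)//.
  + congr (_%:E); rewrite subrr mul0r !exprS zn divff// !expr1n.
    by field; rewrite addrC natr1.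
  + move=> x xa; have xb := lt_trans xa hab.
    by rewrite upper_cdf_ltb// poly_possibility_below.
  + move=> x /andP[ax xb].
    by rewrite upper_cdf_ltb// poly_possibility_left ?mulN1r// ltW.
  + by move=> x bx; rewrite upper_cdf_geb// ltW.
(* lower_cdf is T ^+ n on ]c, d[ with T = 0 at c and T = 1 at d, so the
   integral is G d - G c = G d - 0. *)
- rewrite (integral_id_derive1_power_ramp _ n c (d - c) 1 0 c d 0 1)//.
  + congr (_%:E); rewrite subrr mul0r !exprS zn divff// !expr1n.
    by field; rewrite addrC natr1.
  + by move=> x xc; exact: lower_cdf_ltc.
  + move=> x /andP[cx xd]; have cxd : c < x <= d by rewrite cx ltW.
    by rewrite lower_cdf_gtc// poly_possibility_right// subKr add0r mul1r.
  + move=> x dx; have cx := lt_trans hcd dx.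
    by rewrite lower_cdf_gtc// poly_possibility_above// subr0.
Qed.
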